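(* Let $T_1>0$, let $n\ge 1$ be an integer, let $r$ be real with $0\le r<T_1$, and put $T_2=nT_1+r$. Let $\delta>0$ and let $m\ge1$ be an integer. For an integer $l\ge 1$ consider the (max,+) recursion $$x_1(k)=\max\bigl(T_1+x_1(k-1),\;r+(l+1)T_1+x_1(k-(l+1))\bigr),$$ rewritten as the first-order system $$x_1(k)=\max\bigl(T_1+x_1(k-1),\;r+T_1+z_l(k-1)\bigr),\qquad z_i(k)=T_1+z_{i-1}(k-1)\ (1\le i\le l),\qquad z_0(k):=x_1(k),$$ together with the separate system $y_i(k)=\delta+y_{i-1}(k-1)$ for $1\le i\le m$ and $y_0(k)=\delta+y_m(k-1)$. Then the maximum cycle mean of the precedence graph of the $y$-system is $\lambda_2=\delta$, and the maximum cycle mean of the precedence graph of the $(x_1,z_1,\dots,z_l)$-system is $$\lambda_1=\frac{(l+1)T_1+r}{l+1}$$ for every integer $l\ge1$. Moreover $\lim_{l\to\infty}\lambda_1=T_1$, and this is the infimum of $\lambda_1$ over $l$ (the minimum value of $\lambda_1$ occurs at $l=\infty$).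
   Context: The (max,+) semiring is $\mathbb{R}\cup\{-\infty\}$ with $a\oplus b=\max(a,b)$ and $a\otimes b=a+b$. A first-order linear (max,+) system $X(k)=A\otimes X(k-1)$ means $X_i(k)=\max_j (A_{ij}+X_j(k-1))$. The precedence graph of $A$ has one node per coordinate and an edge $(i,j)$ of weight $A_{ji}$ whenever $A_{ji}\ne-\infty$. The maximum cycle mean is the maximum over all (directed) circuits of (sum of edge weights)/(number of edges). For an irreducible matrix this is its unique (max,+) eigenvalue, i.e. the unique $\lambda$ with $A\otimes X=\lambda\otimes X$ for some eigenvector $X$. With coordinates ordered $(x_1,z_l,z_{l-1},\dots,z_1)$, the $(l+1)\times(l+1)$ matrix of the $(x_1,z)$-system has $A_{1,1}=T_1$, $A_{1,2}=T_1+r$, $A_{i,i+1}=T_1$ for $2\le i\le l$, $A_{l+1,1}=T_1$, and all other entries $-\infty$. *)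

(* Defs.v *)
From HB Require Import structures.
From mathcomp Require Import all_boot all_order all_algebra.
From mathcomp Require Import all_classical all_reals all_analysis.
From mathcomp Require Import zify ring lra.

Set Implicit Arguments.
Unset Strict Implicit.
Unset Printing Implicit Defensive.

Import Order.TTheory GRing.Theory Num.Theory.
Import numFieldNormedType.Exports.

Local Open Scope classical_set_scope.
Local Open Scope ring_scope.

(* R with -oo adjoined.  With the semiring structure below, the generic
   operations +, *, 0, 1 and *m on [maxplus R] are the (max,+) operations:
   addition is max, multiplication is +, the zero is -oo, the unit is 0 : R. *)
Definition maxplus (R : Type) : Type := option R.

Definition mpfin (R : Type) (a : R) : maxplus R := Some a.
Definition mpninf (R : Type) : maxplus R := None.
Arguments mpninf {R}.

Section Semiring.
Variable R : realDomainType.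

HB.instance Definition _ := Choice.copy (maxplus R) (option R).

Definition mpadd (a b : maxplus R) : maxplus R :=
  match a, b with
  | Some x, Some y => Some (Num.max x y)
  | None, c | c, None => c
  end.

Definition mpmul (a b : maxplus R) : maxplus R :=
  if a is Some x then if b is Some y then Some (x + y) else None else None.

Let mpaddA : associative mpadd.
Proof. by move=> [x|] [y|] [z|] //=; rewrite maxA. Qed.

Let mpaddC : commutative mpadd.
Proof. by move=> [x|] [y|] //=; rewrite maxC. Qed.

Let mpadd0 : left_id mpninf mpadd.
Proof. by case. Qed.

HB.instance Definition _ :=
  GRing.isNmodule.Build (maxplus R) mpaddA mpaddC mpadd0.

Let mpmulA : associative mpmul.
Proof. by move=> [x|] [y|] [z|] //=; rewrite addrA. Qed.

Let mpmulC : commutative mpmul.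
Proof. by move=> [x|] [y|] //=; rewrite addrC. Qed.

Let mpmul1 : left_id (mpfin 0) mpmul.
Proof. by case=> [x|] //=; rewrite add0r. Qed.

Let mpmulDl : left_distributive mpmul mpadd.
Proof. by move=> [x|] [y|] [z|] //=; rewrite addr_maxl. Qed.

Let mpmul0 : left_zero mpninf mpmul.
Proof. by []. Qed.

Let mp1_neq0 : mpfin (0 : R) != mpninf.
Proof. by []. Qed.

HB.instance Definition _ := GRing.Nmodule_isComNzSemiRing.Build (maxplus R)
  mpmulA mpmulC mpmul1 mpmulDl mpmul0 mp1_neq0.

End Semiring.

Section PrecedenceGraph.
Variables (R : realFieldType) (n : nat) (A : 'M[maxplus R]_n).

(* An edge (i, j) carries the entry A j i, with the indices swapped. *)
Definition prec_edge : rel 'I_n := fun i j => A j i != mpninf.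

(* The value 0 taken on non-edges is never used on a circuit. *)
Definition prec_weight (i j : 'I_n) : R := odflt 0 (A j i).

(* A circuit is the nonempty sequence of the origins of its edges; the last
   node is followed by the first.  Nodes may be repeated. *)
Definition circuit (c : seq 'I_n) : bool := (c != [::]) && cycle prec_edge c.

(* [zip c (rot 1 c)] is the list of the edges of c. *)
Definition circuit_weight (c : seq 'I_n) : R :=
  \sum_(e <- zip c (rot 1 c)) prec_weight e.1 e.2.

Definition cycle_mean (c : seq 'I_n) : R := circuit_weight c / (size c)%:R.

Definition is_max_cycle_mean (lam : R) : Prop :=
  (exists2 c, circuit c & cycle_mean c = lam) /\
  (forall c, circuit c -> cycle_mean c <= lam).

End PrecedenceGraph.

Section Systems.
Variable R : realType.

(* Trajectories are indexed by k : int.  A family z : nat -> int -> R encodes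
   (x_1, z_1, ..., z_l), with z 0 = x_1. *)

Definition x_recursion (T1 r : R) (l : nat) (x : int -> R) : Prop :=
  forall k, x k = Num.max (T1 + x (k - 1))
                          (r + l.+1%:R * T1 + x (k - l.+1%:Z)).

Definition xz_system (T1 r : R) (l : nat) (z : nat -> int -> R) : Prop :=
  forall k,
    z 0%N k = Num.max (T1 + z 0%N (k - 1)) (r + T1 + z l (k - 1)) /\
    forall i, (1 <= i <= l)%N -> z i k = T1 + z i.-1 (k - 1).

Definition y_system (delta : R) (m : nat) (y : nat -> int -> R) : Prop :=
  forall k,
    y 0%N k = delta + y m (k - 1) /\
    forall i, (1 <= i <= m)%N -> y i k = delta + y i.-1 (k - 1).

(* Coordinates in the order (x_1, z_l, z_(l-1), ..., z_1), numbered from 0. *)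
Definition xz_state (l : nat) (z : nat -> int -> R) (k : int) :
    'cV[maxplus R]_l.+1 :=
  \col_i mpfin (z (if i == 0 :> nat then 0 else l.+1 - i)%N k).

(* Entries, numbered from 1: A_(1,1) = T1, A_(1,2) = T1 + r,
   A_(i,i+1) = T1 for 2 <= i <= l, A_(l+1,1) = T1. *)
Definition xz_matrix (T1 r : R) (l : nat) : 'M[maxplus R]_l.+1 :=
  \matrix_(i, j)
    if (i == 0 :> nat) && (j == 0 :> nat) then mpfin T1
    else if (i == 0 :> nat) && (j == 1 :> nat) then mpfin (T1 + r)
    else if (0 < i)%N && (j == i.+1 :> nat) then mpfin T1
    else if (i == l :> nat) && (j == 0 :> nat) then mpfin T1
    else mpninf.

(* Coordinates in the order (y_0, ..., y_m). *)
Definition y_state (m : nat) (y : nat -> int -> R) (k : int) :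
    'cV[maxplus R]_m.+1 :=
  \col_i mpfin (y i k).

Definition y_matrix (delta : R) (m : nat) : 'M[maxplus R]_m.+1 :=
  \matrix_(i, j)
    if (i == 0 :> nat) && (j == m :> nat) then mpfin delta
    else if (0 < i)%N && (j == i.-1 :> nat) then mpfin delta
    else mpninf.

Lemma mp_sum_single n (F : 'I_n -> maxplus R) (j : 'I_n) :
  (forall i, i != j -> F i = mpninf) -> \sum_i F i = F j.
Proof. by move=> F0; rewrite (bigD1 j) //= big1 ?addr0 // => i /F0. Qed.

Lemma mpfin_inj : injective (@mpfin R).
Proof. by move=> a b []. Qed.

Lemma x_recursion_xz_system (T1 r : R) (l : nat) (x : int -> R) :
  x_recursion T1 r l x <->
  exists2 z : nat -> int -> R, z 0%N =1 x & xz_system T1 r l z.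
Proof.
have shift (k : int) (i : nat) : k - 1 - i%:Z = k - i.+1%:Z by lia.
split=> [xrec | [z z0 zsys] k].
  exists (fun i k => i%:R * T1 + x (k - i%:Z)) => [k|k].
    by rewrite mul0r add0r subr0.
  split.
    rewrite !mul0r !add0r !subr0 xrec shift; congr (Num.max _ _).
    by rewrite -natr1; ring.
  case=> // i _; rewrite /= shift -natr1; ring.
have zE i k' : (i <= l)%N -> z i k' = i%:R * T1 + x (k' - i%:Z).
  elim: i k' => [|i IH] k' il; first by rewrite mul0r add0r subr0 z0.
  have [_ ->] := zsys k'; last by rewrite il.
  rewrite IH 1?ltnW // shift -natr1; ring.
have [+ _] := zsys k; rewrite !z0 zE // shift => ->.
by congr (Num.max _ _); rewrite -natr1; ring.
Qed.

Lemma xz_systemE (T1 r : R) (l : nat) (z : nat -> int -> R) : (1 <= l)%N ->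
  xz_system T1 r l z <->
  forall k, xz_state l z k = xz_matrix T1 r l *m xz_state l z (k - 1).
Proof.
case: l => // l _.
have row0 k : (xz_matrix T1 r l.+1 *m xz_state l.+1 z k) ord0 0 =
    mpfin (Num.max (T1 + z 0%N k) (r + T1 + z l.+1 k)).
  rewrite !mxE big_ord_recl big_ord_recl big1 ?addr0 => [|i _].
    by rewrite !mxE /= subSS subn0 (addrC r).
  by rewrite !mxE.
have rowS k (i : 'I_l.+1) :
    (xz_matrix T1 r l.+1 *m xz_state l.+1 z k) (lift ord0 i) 0 =
    mpfin (T1 + z (l - i)%N k).
  rewrite !mxE; have [il|il] := ltnP i l.
    have i2 : (i.+2 < l.+2)%N by rewrite !ltnS.
    rewrite (mp_sum_single (j := Ordinal i2)) => [|j].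
      by rewrite !mxE /= /bump /= add1n eqxx !subSS.
    rewrite -val_eqE !mxE /= /bump /= add1n => /negPf ->.
    by rewrite eqSS (ltn_eqF il).
  have {}il : i = l :> nat by apply/eqP; rewrite eqn_leq il -ltnS ltn_ord.
  rewrite (mp_sum_single (j := ord0)) => [|j].
    by rewrite !mxE /= /bump /= add1n il eqxx subnn.
  rewrite -val_eqE !mxE /= /bump /= add1n il => /negPf ->.
  by rewrite andbF ltn_eqF // ltn_ord.
split=> [zsys k|zsys k].
  have [e0 eS] := zsys k; apply/matrixP => i j; rewrite ord1 {j}.
  case: (unliftP ord0 i) => [{}i|] ->; last by rewrite row0 !mxE /= e0.
  rewrite rowS !mxE /= /bump /= add1n subSS eS; last first.
    by rewrite subn_gt0 ltn_ord leq_subr.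
  by rewrite subSn //= -ltnS ltn_ord.
have /matrixP eqX := zsys k; split.
  by have := eqX ord0 0; rewrite row0 !mxE /= => /mpfin_inj.
case=> // i il; have li : (l - i < l.+1)%N by rewrite ltnS leq_subr.
have := eqX (lift ord0 (Ordinal li)) 0.
rewrite rowS !mxE /= /bump /= add1n subSS => /mpfin_inj.
by rewrite subSn ?leq_subr // subKn.
Qed.

Lemma y_systemE (delta : R) (m : nat) (y : nat -> int -> R) :
  y_system delta m y <->
  forall k, y_state m y k = y_matrix delta m *m y_state m y (k - 1).
Proof.
have row0 k : (y_matrix delta m *m y_state m y k) ord0 0 =
    mpfin (delta + y m k).
  rewrite !mxE (mp_sum_single (j := ord_max)) => [|j].
    by rewrite !mxE /= eqxx.
  by rewrite -val_eqE !mxE /= => /negPf ->.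
have rowS k (i : 'I_m.+1) : (0 < i)%N ->
    (y_matrix delta m *m y_state m y k) i 0 = mpfin (delta + y i.-1 k).
  move=> i0; have i1 : (i.-1 < m.+1)%N := leq_ltn_trans (leq_pred _) (ltn_ord i).
  rewrite !mxE (mp_sum_single (j := Ordinal i1)) => [|j].
    by rewrite !mxE /= i0 (gtn_eqF i0) eqxx.
  by rewrite -val_eqE !mxE /= i0 (gtn_eqF i0) => /negPf ->.
split=> [ysys k|ysys k].
  have [e0 eS] := ysys k; apply/matrixP => i j; rewrite ord1 {j}.
  have [i0|i0] := posnP i.
    by rewrite (_ : i = ord0) ?row0 ?mxE ?e0 //; apply: val_inj.
  by rewrite rowS // !mxE eS // i0 -ltnS ltn_ord.
have /matrixP eqX := ysys k; split.
  by have := eqX ord0 0; rewrite row0 !mxE /= => /mpfin_inj.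
move=> i /andP[i0 im].
by have := eqX (Ordinal (im : i < m.+1)%N) 0; rewrite rowS // !mxE => /mpfin_inj.
Qed.

End Systems.

(* Main.v *)
Require Import Defs.
From mathcomp Require Import all_boot all_order all_algebra.
From mathcomp Require Import all_classical all_reals all_analysis.
From mathcomp Require Import ring lra.

Import Order.TTheory GRing.Theory Num.Theory.
Import numFieldNormedType.Exports.

Local Open Scope classical_set_scope.
Local Open Scope ring_scope.

(** A real potential [p] on the nodes that satisfies
    [w(i, j) + p i <= lam + p j] on every edge bounds all cycle means by [lam],
    because the differences of [p] telescope to zero around a circuit; a
    circuit along which all these inequalities are equalities has mean exactly
    [lam] ([max_cycle_mean_potential]).  When some tight edge enters every
    node, as for both systems here, [p] is a (max,+) eigenvector for [lam].

    In the y-system every edge weighs [delta], and [p = 0] is tight along the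
    circuit through all nodes.  In the (x_1, z)-system put [lam = T1 + e] with
    [e = r / (l + 1)].  Relative to [lam], each edge of the long circuit
    [x_1 -> z_1 -> ... -> z_l -> x_1] has weight [- e], except the last one,
    which has weight [l * e]; so letting [p] fall by [e] at each step is tight
    along this circuit, while the loop at [x_1] has relative weight
    [- e <= 0] ([xz_matrix_max_cycle_mean]).

    Finally [lambda1 l = T1 + r / (l + 1)] tends to [T1] from above, and a
    limit that is a lower bound is the infimum ([inf_cvg]). *)

(** * Cycle means and potentials *)

Lemma path_all_zip (T : Type) (e : rel T) x s y :
  path e x (rcons s y) = all (fun a => e a.1 a.2) (zip (x :: s) (rcons s y)).
Proof. by elim: s x => [|z s IHs] x /=; rewrite ?IHs. Qed.

Lemma cycle_all_zip (T : Type) (e : rel T) c :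
  cycle e c = all (fun a => e a.1 a.2) (zip c (rot 1 c)).
Proof. by case: c => // x s; rewrite rot1_cons -path_all_zip. Qed.

(** Both sums run over the nodes of [c]: [rot 1 c] is a permutation of [c]. *)
Lemma sum_potential_cycle (T : eqType) (V : zmodType) (p : T -> V) c :
  \sum_(a <- zip c (rot 1 c)) (p a.2 - p a.1) = 0.
Proof.
rewrite sumrB -(big_map snd xpredT p) -(big_map fst xpredT p).
rewrite -/(unzip1 _) -/(unzip2 _) unzip1_zip ?unzip2_zip ?size_rot //.
by rewrite (perm_big c) ?perm_rot // subrr.
Qed.

Section Potential.
Variables (R : realFieldType) (n : nat) (A : 'M[maxplus R]_n).
Variables (lam : R) (p : 'I_n -> R).

Let excess (a : 'I_n * 'I_n) := lam + (p a.2 - p a.1).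

Lemma sum_excess c : \sum_(a <- zip c (rot 1 c)) excess a = lam * (size c)%:R.
Proof.
rewrite big_split /= sum_potential_cycle addr0 big_const_seq count_predT.
by rewrite size_zip size_rot minnn iter_addr_0 mulr_natr.
Qed.

Lemma circuit_size_gt0 c : circuit A c -> 0 < (size c)%:R :> R.
Proof. by case/andP; rewrite ltr0n lt0n size_eq0. Qed.

Lemma cycle_mean_le c :
    (forall i j, prec_edge A i j -> prec_weight A i j + p i <= lam + p j) ->
  circuit A c -> cycle_mean A c <= lam.
Proof.
move=> le_p Cc; rewrite ler_pdivrMr ?circuit_size_gt0 // -sum_excess.
have /andP[_] := Cc; rewrite cycle_all_zip => /allP Ec.
rewrite /circuit_weight !big_seq; apply: ler_sum => a /Ec /le_p.
by rewrite /excess addrA lerBrDr.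
Qed.

Lemma cycle_mean_eq c : circuit A c ->
    cycle (fun i j => prec_weight A i j + p i == lam + p j) c ->
  cycle_mean A c = lam.
Proof.
move=> Cc; rewrite cycle_all_zip => /allP tight.
apply: (canLR (mulfK (lt0r_neq0 (circuit_size_gt0 _ Cc)))); rewrite -sum_excess.
rewrite /circuit_weight !big_seq; apply: eq_bigr => a /tight /eqP.
by rewrite /excess addrA => <-; rewrite addrK.
Qed.

(** Injectivity of the successor map [f] makes the [f]-orbit of any node a
    circuit, all of whose edges are tight. *)
Lemma max_cycle_mean_potential (f : 'I_n -> 'I_n) (i0 : 'I_n) :
    injective f ->
    (forall i, prec_edge A i (f i)) ->
    (forall i, prec_weight A i (f i) + p i = lam + p (f i)) ->
    (forall i j, prec_edge A i j -> prec_weight A i j + p i <= lam + p j) ->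
  is_max_cycle_mean A lam.
Proof.
move=> f_inj Ef tight le_p; split=> [|c]; last exact: cycle_mean_le.
have fC : fcycle f (orbit f i0) by apply: cycle_orbit.
have C : circuit A (orbit f i0).
  rewrite /circuit -size_eq0 size_orbit -lt0n order_gt0.
  by apply: sub_cycle fC => i _ /eqP <-.
exists (orbit f i0); first exact: C.
by apply: cycle_mean_eq C _; apply: sub_cycle fC => i _ /eqP <-; apply/eqP.
Qed.

End Potential.

(** * The two systems *)

Lemma val_ordS n (i : 'I_n.+1) :
  ordS i = (if i == n :> nat then 0 else i.+1)%N :> nat.
Proof.
rewrite /=; case: eqP => [->|/eqP i_neq_n]; first by rewrite modnn.
by rewrite modn_small // ltnS ltn_neqAle i_neq_n -ltnS ltn_ord.
Qed.

Lemma val_ord_pred n (i : 'I_n.+1) :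
  ord_pred i = (if i == 0 :> nat then n else i.-1)%N :> nat.
Proof.
rewrite /=; case: eqP => [->|/eqP i_neq0]; first by rewrite modn_small.
rewrite addnS /= -[in LHS](prednK (n := i)) ?lt0n // addSnnS modnDr modn_small //.
exact: leq_ltn_trans (leq_pred i) (ltn_ord i).
Qed.

Lemma y_matrix_max_cycle_mean (R : realType) (delta : R) (m : nat) :
  is_max_cycle_mean (y_matrix delta m) delta.
Proof.
have step i : y_matrix delta m (ordS i) i = mpfin delta.
  rewrite mxE val_ordS; case: (eqVneq (i : nat) m) => //= _.
  by rewrite eqxx.
apply: (@max_cycle_mean_potential _ _ _ _ (fun=> 0) _ ord0 (@ordS_inj _)).
- by move=> i; rewrite /prec_edge step.
- by move=> i; rewrite /prec_weight step.
move=> i j; rewrite /prec_edge /prec_weight mxE !addr0.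
by do 2?case: ifP.
Qed.

Lemma xz_matrix_max_cycle_mean (R : realType) (T1 r : R) (l : nat) :
    0 <= r -> (1 <= l)%N ->
  is_max_cycle_mean (xz_matrix T1 r l) ((l.+1%:R * T1 + r) / l.+1%:R).
Proof.
move=> r_ge0 l_gt0; set e := r / l.+1%:R.
have e_ge0 : 0 <= e by rewrite divr_ge0.
have rE : r = (l%:R + 1) * e by rewrite natr1 mulrCA mulfV ?mulr1 ?pnatr_eq0.
have -> : (l.+1%:R * T1 + r) / l.+1%:R = T1 + e.
  by rewrite mulrDl mulrAC mulfV ?mul1r ?pnatr_eq0.
(* Node [i > 0] is the coordinate z_(l + 1 - i), reached from x_1 in
   [l + 1 - i] edges. *)
pose p (i : 'I_l.+1) : R :=
  if i == 0 :> nat then 0 else - ((l%:R + 1 - i%:R) * e).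
have step i : xz_matrix T1 r l (ord_pred i) i =
    mpfin (if i == 1 :> nat then T1 + r else T1).
  rewrite mxE val_ord_pred; have [i0|i_gt0] := posnP i.
    by rewrite i0 eqxx (gtn_eqF l_gt0) /= andbF.
  rewrite andbF andbF.
  case: (eqVneq (i : nat) 1%N) => [->|i_neq1] //.
  have i_gt1 : (1 < i)%N by rewrite ltn_neqAle eq_sym i_neq1.
  by rewrite andbF -subn1 subn_gt0 i_gt1 subn1 prednK // eqxx.
have pE (i : 'I_l.+1) : (0 < i)%N -> p i = - ((l%:R + 1 - i%:R) * e).
  by rewrite /p => /gtn_eqF ->.
have p0 (i : 'I_l.+1) : i = 0%N :> nat -> p i = 0 by rewrite /p => ->.
apply: (@max_cycle_mean_potential _ _ _ _ p _ ord0 (@ord_pred_inj _)).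
- by move=> i; rewrite /prec_edge step.
- move=> i; rewrite /prec_weight step; move: (ord_pred i) (val_ord_pred l i) => j.
  have [i0|i_gt0] := posnP i; rewrite ?i0 ?(gtn_eqF i_gt0) => vi.
    by rewrite (p0 i) // (pE j) vi //=; ring.
  rewrite (pE i) //; case: (eqVneq (i : nat) 1%N) vi => [->|i_neq1] vi.
    by rewrite (p0 j) // rE /=; ring.
  have i_gt1 : (1 < i)%N by rewrite ltn_neqAle eq_sym i_neq1.
  rewrite (pE j) vi /=; last by rewrite -subn1 subn_gt0.
  by rewrite -[in LHS](prednK i_gt0) -natr1; ring.
move=> i j; rewrite /prec_edge /prec_weight mxE.
case: ifP => [/andP[/eqP j0 /eqP i0] _|_].
  by rewrite !p0 //= !addr0 lerDl.
case: ifP => [/andP[/eqP j0 /eqP i1] _|_].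
  by rewrite (p0 j) // pE i1 //= rE; lra.
case: ifP => [/andP[j_gt0 /eqP ij] _|_].
  by rewrite !pE ?ij //= -natr1; lra.
case: ifP => [/andP[/eqP jl /eqP i0] _|_] //.
by rewrite (p0 i) // pE jl //=; lra.
Qed.

(** * Behaviour for large [l] *)

Lemma inf_cvg (R : realType) (u : nat -> R) (P : set nat) (a : R) :
    (\forall k \near \oo, P k) -> (forall k, P k -> a <= u k) ->
    u k @[k --> \oo] --> a ->
  inf [set u k | k in P] = a.
Proof.
move=> nearP le_a cvg_u; set S := [set _ | _ in _].
have aS : lbound S a by move=> _ [k Pk <-]; apply: le_a.
have S0 : S !=set0.
  by have [k Pk] := @filter_ex _ \oo _ _ nearP; exists (u k), k.
apply/eqP; rewrite eq_le lb_le_inf // andbT.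
apply: (cvgr_to_ge cvg_u); apply: filterS nearP => k Pk.
by apply: ge_inf; [exists a | exists k].
Qed.

Theorem mainTheorem2 (R : realType) (T1 r T2 delta : R) (n m : nat)
    (hT1 : 0 < T1) (hn : (1 <= n)%N) (hr : 0 <= r < T1)
    (hT2 : T2 = n%:R * T1 + r) (hdelta : 0 < delta) (hm : (1 <= m)%N) :
  let lambda1 (l : nat) : R := (l.+1%:R * T1 + r) / l.+1%:R in
  [/\ is_max_cycle_mean (y_matrix delta m) delta,
      forall l : nat, (1 <= l)%N ->
        is_max_cycle_mean (xz_matrix T1 r l) (lambda1 l),
      lambda1 l @[l --> \oo] --> T1 &
      inf [set lambda1 l | l in [set l : nat | (1 <= l)%N]] = T1].
Proof.
move=> lambda1; have /andP[r_ge0 _] := hr.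
have lambda1E l : lambda1 l = T1 + r * harmonic l.
  by rewrite /lambda1 mulrDl mulrAC mulfV ?mul1r ?pnatr_eq0.
have cvg_lambda1 : lambda1 l @[l --> \oo] --> T1.
  under eq_fun do rewrite lambda1E.
  have : T1 + r * harmonic l @[l --> \oo] --> T1 + r * 0.
    by apply: cvgD; [apply: cvg_cst | apply: cvgMl_tmp; apply: cvg_harmonic].
  by rewrite mulr0 addr0.
split=> //; first exact: y_matrix_max_cycle_mean.
  by move=> l; apply: xz_matrix_max_cycle_mean.
apply: inf_cvg cvg_lambda1 => [|l _]; first exact: nbhs_infty_ge.
by rewrite lambda1E lerDl mulr_ge0 // invr_ge0.
Qed.
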